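(* Let $p\ge 1$ be an integer. The following two assertions are equivalent. (a) For every integer $n\ge p$, the polynomial $s_{n,p}$ is $\mathbb{I}$-hyperbolic. (b) For all $P,Q\in\mathbb{R}[X]$ with $\deg P=\deg Q=p$, if $P$ and $Q$ are real-rooted, then $\sum_{k=0}^p P^{(k)}Q^{(p-k)}$ is real-rooted as well.
   Context: $\sigma_k$ denotes the $k$-th elementary symmetric polynomial in the coordinates of its vector argument ($\sigma_0=1$). For $n\ge p$, the semi-symmetric polynomial $s_{n,p}$ is the polynomial in $n+p$ variables $s_{n,p}(x,\lambda)=\sum_{k=0}^p \frac{\sigma_k(x)\,\sigma_{p-k}(\lambda)}{\binom{n}{k}}$ for $x\in\mathbb{R}^n$, $\lambda\in\mathbb{R}^p$. $\mathbb{I}=(1,\ldots,1)$, in whatever dimension is appropriate. A polynomial $P\in\mathbb{R}[X_1,\ldots,X_N]$ is $v$-hyperbolic, for $v\in\mathbb{R}^N$, if $P$ is homogeneous, $P(v)>0$, and for every $x\in\mathbb{R}^N$ the one-variable polynomial $P(x+X\cdot v)\in\mathbb{R}[X]$ is real-rooted. A real polynomial is real-rooted if all its complex roots are real. $P^{(k)}$ is the $k$-th derivative of $P$. *)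

(* Defs.v *)
From mathcomp Require Import all_boot all_order all_algebra.
From mathcomp Require Import complex.
From mathcomp Require Import mpoly.

Set Implicit Arguments.
Unset Strict Implicit.
Unset Printing Implicit Defensive.

Import GRing.Theory Num.Theory.

Local Open Scope ring_scope.

(* The zero polynomial is not [real_rooted]: every complex number is a root. *)
Definition real_rooted (R : rcfType) (P : {poly R}) : Prop :=
  forall z : R[i], root (map_poly (real_complex R) P) z -> complex.Im z = 0.

(* The univariate polynomial P(x + X v), the variable X being ['X]. *)
Definition line_restriction (R : comNzRingType) (N : nat)
    (P : {mpoly R[N]}) (x v : 'I_N -> R) : {poly R} :=
  mmap (@polyC R) (fun i => (x i)%:P + v i *: 'X) P.

Definition hyperbolic (R : rcfType) (N : nat)
    (v : 'I_N -> R) (P : {mpoly R[N]}) : Prop :=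
  [/\ exists d : nat, P \is d.-homog,
      0 < P.@[v]
    & forall x : 'I_N -> R, real_rooted (line_restriction P x v)].

(* In [{mpoly R[n + p]}] the first n variables are x, the last p are lambda. *)
Definition sigma_x (R : comNzRingType) (n p k : nat) : {mpoly R[n + p]} :=
  mesym n R k \mPo [tuple 'X_(lshift p i) | i < n].

Definition sigma_lambda (R : comNzRingType) (n p k : nat) : {mpoly R[n + p]} :=
  mesym p R k \mPo [tuple 'X_(rshift n j) | j < p].

(* Meaningful for p <= n, where the binomials 'C(n, k) with k <= p are nonzero. *)
Definition semisym (R : fieldType) (n p : nat) : {mpoly R[n + p]} :=
  \sum_(k < p.+1)
     ('C(n, k)%:R : R)^-1 *: (sigma_x R n p k * sigma_lambda R n p (p - k)).

(* Main.v *)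
(* For x in R^n put A = \prod_i (X + x_i). By Taylor's formula and Viete's,
   sigma_k(x + X I) = A^(n-k) / (n-k)!. Hence s_(n,p) restricted to a line of
   direction I is, up to the factor 1/n!, the polynomial
   \sum_k A^(n-k) B^(k) with B = \prod_j (X + lambda_j), that is
   \sum_k P^(p-k) B^(k) with P = A^(n-p). Since P is real-rooted of degree p
   (Gauss-Lucas), (b) implies (a); since P = A is arbitrary up to a scalar when
   n = p, the single case n = p of (a) implies (b). *)
Require Import Defs.
From mathcomp Require Import all_boot all_order all_algebra.
From mathcomp Require Import reals.
From mathcomp Require Import complex cauchyreals mpoly ring.

Import Order.TTheory GRing.Theory Num.Theory.

Local Open Scope ring_scope.

(** * Real-rooted polynomials and their derivatives *)

Lemma real_rootedZ {R : rcfType} {c : R} {P : {poly R}} :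
  c != 0 -> real_rooted (c *: P) <-> real_rooted P.
Proof.
move=> c0; have c0' : real_complex R c != 0 by rewrite fmorph_eq0.
by split=> rP z; move: (rP z); rewrite map_polyZ rootZ.
Qed.

(** The factorization over [R[i]] descends to [R]: each root equals its real part, and [map_poly]
    along the embedding is injective. *)
Lemma real_rooted_splits {R : rcfType} {P : {poly R}} :
  real_rooted P ->
  exists rs : seq R, P = lead_coef P *: \prod_(r <- rs) ('X - r%:P).
Proof.
move=> rP; pose C := real_complex R.
have [cs Pcs] := closed_field_poly_normal (map_poly C P).
have [P0|P0] := eqVneq P 0; first by exists [::]; rewrite P0 lead_coef0 scale0r.
exists (map (@complex.Re R) cs); apply: (@map_poly_inj _ _ C).
rewrite {1}Pcs lead_coef_map map_polyZ rmorph_prod big_map /=; congr (_ *: _).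
apply: eq_big_seq => c c_cs; rewrite map_polyXsubC.
suff /rP : root (map_poly C P) c by case: c {c_cs} => a b /= ->.
by rewrite Pcs rootZ ?lead_coef_eq0 ?map_poly_eq0 // root_prod_XsubC.
Qed.

(** For [z = a + bi], the imaginary part of [1 / (z - r)] is [- b / |z - r|^2]. *)
Lemma Im_inv_sub_real {R : rcfType} (z : R[i]) (r : R) :
  complex.Im z != 0 -> complex.Im (z - r%:C%C)^-1 * complex.Im z < 0.
Proof.
case: z => a b /= b0; rewrite subr0 mulNr oppr_lt0 mulrAC divr_gt0 //.
  by rewrite -expr2 exprn_even_gt0.
by rewrite ltr_wpDl ?sqr_ge0 // exprn_even_gt0.
Qed.

(* The logarithmic derivative [\sum_r 1 / (z - r)] has an imaginary part of sign
   opposite to that of [Im z]; this is the Gauss-Lucas argument. *)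
Lemma Im_logderiv_prod_XsubC {R : rcfType} (z : R[i]) (rs : seq R) :
  complex.Im z != 0 -> rs != [::] ->
  let P := \prod_(r <- rs) ('X - (r%:C%C)%:P) in
  complex.Im (P^`().[z] / P.[z]) * complex.Im z < 0.
Proof.
move=> z0; have zr0 (r : R) : z - r%:C%C != 0.
  by apply: contraNneq z0 => /subr0_eq->.
elim: rs => //= r rs IH _; rewrite big_cons; set Q := \prod_(r <- rs) _.
have Q0 : Q.[z] != 0.
  rewrite /Q horner_prod prodf_seq_neq0; apply/allP => s _ /=.
  by rewrite hornerXsubC.
have -> : (('X - (r%:C%C)%:P) * Q)^`().[z] / (('X - (r%:C%C)%:P) * Q).[z]
          = (z - r%:C%C)^-1 + Q^`().[z] / Q.[z].
  rewrite derivM derivXsubC !hornerE.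
  by field; rewrite zr0 Q0.
have ImD (u v : R[i]) : complex.Im (u + v) = complex.Im u + complex.Im v.
  by case: u v => ? ? [].
rewrite ImD mulrDl ltr_wnDr ?Im_inv_sub_real //.
(* The tail may be empty, with logarithmic derivative 0; a weak inequality suffices for it, since
   the head term is strict. *)
have [rs0|/IH/ltW//] := eqVneq rs [::].
by rewrite /Q rs0 big_nil derivC horner0 !mul0r.
Qed.

(** A nonreal root of the derivative would annul the logarithmic derivative, whose imaginary part is
    nonzero there. Constants are excluded because their derivative 0 is not [real_rooted]. *)
Lemma real_rooted_deriv {R : rcfType} (P : {poly R}) :
  (1 < size P)%N -> real_rooted P -> real_rooted P^`().
Proof.
move=> P1 /real_rooted_splits[rs Prs].
have lP0 : lead_coef P != 0 by rewrite lead_coef_eq0 -size_poly_gt0 ltnW.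
have rs0 : rs != [::].
  apply: contraTneq P1 => rs0.
  by rewrite Prs rs0 big_nil alg_polyC size_polyC lP0.
rewrite Prs derivZ; apply/(real_rootedZ lP0) => z.
rewrite -deriv_map rmorph_prod.
under eq_bigr do rewrite /= map_polyXsubC.
move=> /rootP dPz; apply/eqP; apply: contraT => z0.
have := Im_logderiv_prod_XsubC z rs z0 rs0.
by rewrite /= dPz mul0r mul0r ltxx.
Qed.

Lemma real_rooted_derivn {R : rcfType} (P : {poly R}) (n : nat) :
  (n < size P)%N -> real_rooted P -> real_rooted P^`(n).
Proof.
elim: n => // n IH nP rP; rewrite derivnS.
apply: real_rooted_deriv (IH (ltnW nP) rP).
by rewrite size_derivn ltn_subRL addn1.
Qed.

Lemma real_rooted_prod_XsubC {R : rcfType} (rs : seq R) :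
  real_rooted (\prod_(r <- rs) ('X - r%:P)).
Proof.
move=> z; rewrite rmorph_prod.
under eq_bigr do rewrite /= map_polyXsubC.
by rewrite -(big_map (real_complex R) xpredT (fun r => 'X - r%:P))
  root_prod_XsubC => /mapP[r _ ->].
Qed.

(** * Formulas of Viete and Taylor *)

(** In the expanded product, [h] is the set of factors that contribute their constant. The base ring
    is general so that the [c i] may themselves be polynomials. *)
Lemma coef_prod_XaddC {R : comNzRingType} (n k : nat) (c : 'I_n -> R) :
  (k <= n)%N ->
  (\prod_(i < n) ('X + (c i)%:P))`_(n - k)
  = \sum_(h : {set 'I_n} | #|h| == k) \prod_(i in h) c i.
Proof.
move=> kn; under eq_bigr do rewrite addrC.
rewrite bigA_distr coef_sum [RHS]big_mkcond; apply: eq_bigr => h _.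
have -> : \prod_i (if i \in h then (c i)%:P else 'X)
          = (\prod_(i in h) c i)%:P * 'X^(n - #|h|).
  rewrite (bigID (mem h)) /= rmorph_prod; congr (_ * _).
    by apply: eq_bigr => i ->.
  have <- : #|~: h| = (n - #|h|)%N by rewrite cardsCs setCK card_ord.
  by rewrite -prodr_const; apply: eq_big => i; rewrite ?inE // => /negPf->.
have hn : (#|h| <= n)%N by have := max_card (mem h); rewrite card_ord.
rewrite coefCM coefXn eqn_sub2lE // eq_sym.
by case: eqP; rewrite ?mulr1 ?mulr0.
Qed.

(* Taylor's formula, the increment being a second variable. *)
Lemma coef_taylor {R : comNzRingType} (P : {poly R}) (j : nat) :
  (map_poly (polyC \o polyC) P).['X%:P + 'X]`_j = P^`N(j).
Proof.
set Q := map_poly _ P.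
(* The expansion runs beyond [size Q] so that the index [j] always occurs in it. *)
rewrite (@nderiv_taylor_wide _ (size Q + j).+1) ?leqW ?leq_addr //;
  last exact: mulrC.
rewrite coef_sum (bigD1 (inord j)) //= inordK ?ltnS ?leq_addl // big1 ?addr0.
  rewrite /Q nderivn_map /= map_poly_comp horner_map -/(P^`N(j) ^:P) /=.
  by rewrite coefCM coefXn eqxx mulr1 -[RHS]comp_polyXr.
move=> i ij; rewrite /Q nderivn_map /= map_poly_comp horner_map coefCM coefXn.
case: eqP => [ji|]; last by rewrite mulr0.
by case/eqP: ij; apply: val_inj; rewrite /= inordK ?ltnS ?leq_addl.
Qed.

(** Both sides are the coefficient of [Y^(n - k)] in [\prod_i (Y + (X + c i))]: the left by Taylor's
    formula, the right by Viete's. *)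
Lemma nderivn_prod_XaddC {R : comNzRingType} (n k : nat) (c : 'I_n -> R) :
  (k <= n)%N ->
  (\prod_(i < n) ('X + (c i)%:P))^`N(n - k)
  = \sum_(h : {set 'I_n} | #|h| == k) \prod_(i in h) ('X + (c i)%:P).
Proof.
move=> kn; rewrite -coef_prod_XaddC //; set A := \prod_i _.
have -> : \prod_i ('X + ('X + (c i)%:P)%:P)
          = (map_poly (polyC \o polyC) A).['X%:P + 'X].
  rewrite rmorph_prod horner_prod; apply: eq_bigr => i _ /=.
  rewrite [in RHS]rmorphD /= map_polyX map_polyC /= hornerD hornerX hornerC.
  by rewrite polyCD addrCA addrA.
by rewrite coef_taylor.
Qed.

(** * The semi-symmetric polynomial: homogeneity, value at the all-ones vector, restriction to
    lines *)

Lemma sigma_xE (R : comNzRingType) (n p k : nat) :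
  sigma_x R n p k
  = \sum_(h : {set 'I_n} | #|h| == k) \prod_(i in h) 'X_(lshift p i).
Proof.
rewrite /sigma_x /mesym rmorph_sum; apply: eq_bigr => h _.
rewrite rmorph_prod; apply: eq_bigr => i _.
by rewrite /= comp_mpolyXU -tnth_nth tnth_mktuple.
Qed.

Lemma sigma_lambdaE (R : comNzRingType) (n p k : nat) :
  sigma_lambda R n p k
  = \sum_(h : {set 'I_p} | #|h| == k) \prod_(i in h) 'X_(rshift n i).
Proof.
rewrite /sigma_lambda /mesym rmorph_sum; apply: eq_bigr => h _.
rewrite rmorph_prod; apply: eq_bigr => i _.
by rewrite /= comp_mpolyXU -tnth_nth tnth_mktuple.
Qed.

Lemma dhomog_prod_X {R : comNzRingType} (m N : nat) (f : 'I_m -> 'I_N)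
    (h : {set 'I_m}) :
  \prod_(i in h) ('X_(f i) : {mpoly R[N]}) \is #|h|.-homog.
Proof.
rewrite -(big_morph (fun mu => 'X_[R, mu]) (@mpolyXD N R) (@mpolyX0 N R)).
rewrite dhomogX /= mdeg_sum; under eq_bigr do rewrite mdeg1.
by rewrite sum1_card.
Qed.

Lemma dhomog_semisym {R : fieldType} (n p : nat) : semisym R n p \is p.-homog.
Proof.
apply: rpred_sum => k _; apply: rpredZ.
suff: sigma_x R n p k * sigma_lambda R n p (p - k) \is (k + (p - k)).-homog.
  by rewrite subnKC // -ltnS.
rewrite sigma_xE sigma_lambdaE; apply: dhomogM;
  by apply: rpred_sum => h /eqP<-; apply: dhomog_prod_X.
Qed.

(** At the all-ones vector an elementary symmetric polynomial counts subsets, so every term of the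
    sum is positive; [p <= n] keeps the binomials nonzero. *)
Lemma semisym_ones_gt0 {R : numFieldType} (n p : nat) :
  (p <= n)%N -> 0 < (semisym R n p).@[fun=> 1].
Proof.
move=> pn; have ones (m N k : nat) (f : 'I_m -> 'I_N) : (k <= m)%N ->
    0 < (\sum_(h : {set 'I_m} | #|h| == k)
           \prod_(i in h) 'X_(f i) : {mpoly R[N]}).@[fun=> 1].
  move=> km; rewrite rmorph_sum /=.
  under eq_bigr do
    [rewrite rmorph_prod; under eq_bigr do rewrite /= mevalXU; rewrite big1_eq].
  by rewrite sumr_const -cardsE card_draws card_ord ltr0n bin_gt0.
have term_gt0 (k : 'I_p.+1) : 0 < (('C(n, k)%:R : R)^-1 *:
    (sigma_x R n p k * sigma_lambda R n p (p - k))).@[fun=> 1].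
  have kn : (k <= n)%N by rewrite (leq_trans _ pn) // -ltnS.
  rewrite mevalZ rmorphM /= sigma_xE sigma_lambdaE !mulr_gt0 ?ones ?leq_subr //.
  by rewrite invr_gt0 ltr0n bin_gt0.
rewrite /semisym rmorph_sum big_ord_recl ltr_pwDl ?term_gt0 //.
by apply: sumr_ge0 => k _; apply/ltW/term_gt0.
Qed.

(** The two symmetric factors become derivatives divided by [(n - k)!] and [k!]; together with the
    inverse of ['C(n, k)] these constants give [1 / n!]. *)
Lemma line_restriction_semisym {R : numFieldType} (n p : nat)
    (z : 'I_(n + p) -> R) :
  (p <= n)%N ->
  line_restriction (semisym R n p) z (fun=> 1)
  = (n`!%:R)^-1 *: \sum_(k < p.+1)
      (\prod_(i < n) ('X + (z (lshift p i))%:P))^`(n - k)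
      * (\prod_(j < p) ('X + (z (rshift n j))%:P))^`(k).
Proof.
move=> pn; rewrite /line_restriction /semisym rmorph_sum scaler_sumr.
apply: eq_bigr => k _ /=; have kp : (k <= p)%N by rewrite -ltnS.
rewrite mmapZ rmorphM /= mul_polyC.
have restrict m (f : 'I_m -> 'I_(n + p)) j :
    mmap (@polyC R) (fun i => (z i)%:P + 1 *: 'X)
      (\sum_(h : {set 'I_m} | #|h| == j) \prod_(i in h) 'X_(f i))
    = \sum_(h : {set 'I_m} | #|h| == j) \prod_(i in h) ('X + (z (f i))%:P).
  rewrite rmorph_sum; apply: eq_bigr => h _.
  rewrite rmorph_prod; apply: eq_bigr => i _.
  by rewrite /= mmapX mmap1U scale1r addrC.
rewrite sigma_xE sigma_lambdaE !restrict.
rewrite -!nderivn_prod_XaddC ?leq_subr ?(leq_trans kp) // subKn //.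
rewrite !nderivn_def mulrnAl mulrnAr -mulrnA -scaler_nat scalerA; congr (_ *: _).
rewrite -(bin_fact (leq_trans kp pn)) !natrM.
have: 'C(n, k)%:R != 0 :> R by rewrite pnatr_eq0 -lt0n bin_gt0 (leq_trans kp).
have: k`!%:R != 0 :> R by rewrite pnatr_eq0 -lt0n fact_gt0.
have: (n - k)`!%:R != 0 :> R by rewrite pnatr_eq0 -lt0n fact_gt0.
by move=> *; field; apply/and3P.
Qed.

Lemma prod_XaddCE {R : comNzRingType} (n : nat) (c : 'I_n -> R) :
  \prod_(i < n) ('X + (c i)%:P)
  = \prod_(r <- [seq - c i | i <- enum 'I_n]) ('X - r%:P).
Proof.
by rewrite big_map big_enum; apply: eq_bigr => i _; rewrite polyCN opprK.
Qed.

Theorem theorem4p9 (R : realType) (p : nat) (hp : (1 <= p)%N) :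
  (forall n : nat, (p <= n)%N ->
     @hyperbolic R (n + p)%N (fun=> 1) (@semisym R n p))
  <->
  (forall P Q : {poly R}, size P = p.+1 -> size Q = p.+1 ->
     real_rooted P -> real_rooted Q ->
     real_rooted (\sum_(k < p.+1) P^`(k) * Q^`(p - k))).
Proof.
have fact_neq0 n : (n`!%:R : R)^-1 != 0.
  by rewrite invr_eq0 pnatr_eq0 -lt0n fact_gt0.
split=> [hyp P Q sP sQ rP rQ | walsh n pn].
  have roots (S : {poly R}) : size S = p.+1 -> real_rooted S ->
      exists a c, a != 0 /\ S = a *: \prod_(i < p) ('X + (c i)%:P).
    move=> sS /real_rooted_splits[rs Srs].
    have S0 : lead_coef S != 0 by rewrite lead_coef_eq0 -size_poly_gt0 sS.
    have srs : size rs = p.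
      by apply: succn_inj; rewrite -sS Srs size_scale // size_prod_XsubC.
    exists (lead_coef S), (fun i => - rs`_i); split; rewrite // {1}Srs.
    congr (_ *: _).
    rewrite (big_nth 0) big_mkord srs.
    by apply: eq_bigr => i _; rewrite polyCN.
  have [a [x [a0 ->]]] := roots P sP rP.
  have [b [y [b0 ->]]] := roots Q sQ rQ.
  have [_ _] := hyp p (leqnn p).
  (* The negated roots of [P] serve as the x coordinates, those of [Q] as the lambda coordinates. *)
  pose z i := match split i with inl j => x j | inr j => y j end.
  move=> /(_ z); rewrite line_restriction_semisym // => /(real_rootedZ (fact_neq0 p)).
  have -> : \prod_i ('X + (z (lshift p i))%:P) = \prod_i ('X + (x i)%:P).
    by apply: eq_bigr => i _; rewrite /z (unsplitK (inl i)).
  have -> : \prod_i ('X + (z (rshift p i))%:P) = \prod_i ('X + (y i)%:P).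
    by apply: eq_bigr => i _; rewrite /z (unsplitK (inr i)).
  set A := \prod_i _; set B := \prod_i _ => rAB.
  have -> : \sum_(k < p.+1) (a *: A)^`(k) * (b *: B)^`(p - k)
            = (a * b) *: \sum_(k < p.+1) A^`(p - k) * B^`(k).
    rewrite (reindex_inj rev_ord_inj) scaler_sumr; apply: eq_bigr => k _.
    have kp : (k <= p)%N by rewrite -ltnS.
    rewrite /= subSS (subKn kp) !derivnZ.
    by rewrite -scalerAl -scalerAr scalerA.
  by apply/(real_rootedZ _) => //; rewrite mulf_neq0.
split; first by exists p; apply: dhomog_semisym.
  exact: semisym_ones_gt0.
move=> z; rewrite line_restriction_semisym //.
apply/(real_rootedZ (fact_neq0 n)).
rewrite !prod_XaddCE; set A := \prod_(r <- _) _; set B := \prod_(r <- _) _.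
have sA : size A = n.+1 by rewrite size_prod_XsubC size_map size_enum_ord.
have sB : size B = p.+1 by rewrite size_prod_XsubC size_map size_enum_ord.
(* Reversing the sum turns the order [n - k] into [n - (p - k) = (n - p) + k], so [n - p]
   derivatives can be taken first; they bring [A] down to degree exactly [p], as [walsh]
   requires. *)
have -> : \sum_(k < p.+1) A^`(n - k) * B^`(k)
          = \sum_(k < p.+1) A^`(n - p)^`(k) * B^`(p - k).
  rewrite (reindex_inj rev_ord_inj); apply: eq_bigr => k _.
  have kp : (k <= p)%N by rewrite -ltnS.
  by rewrite /= subSS /derivn -iterD addnC subnBA // addnBAC.
apply: walsh => //; last exact: real_rooted_prod_XsubC.
  by rewrite size_derivn sA subSn ?leq_subr // subKn.
apply: real_rooted_derivn; first by rewrite sA ltnS leq_subr.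
exact: real_rooted_prod_XsubC.
Qed.
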